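(* Let $G$ be a finite simple undirected graph and let $r,m\in\mathbb{N}$. Let $c\in\mathbb{N}$ be such that $\mathrm{wcol}_r(G)\leq c$, and let $A\subseteq V(G)$ be a set of size at least $(c+1)\cdot 2^m$. Then there exist a set $S\subseteq V(G)$ of size at most $c(c-1)$ and a set $B\subseteq A$ of size at least $m$ which is $r$-independent in $G-S$.
   Context: For a linear order $L$ of $V(G)$ and $v\in V(G)$, a vertex $u$ is weakly $r$-reachable from $v$ with respect to $L$ if there is a path of length at most $r$ (length = number of edges) connecting $u$ and $v$ such that $u$ is the $L$-minimum vertex of the path; $\mathrm{WReach}_r[G,L,v]$ denotes the set of such vertices (it contains $v$). The weak $r$-colouring number is $\mathrm{wcol}_r(G)=\min_{L}\max_{v\in V(G)}|\mathrm{WReach}_r[G,L,v]|$, the minimum over all linear orders $L$ of $V(G)$. A vertex set $B$ is $r$-independent in a graph $H$ if $B\subseteq V(H)$ and $\mathrm{dist}_H(a,b)>r$ for all distinct $a,b\in B$. $G-S$ denotes the graph obtained from $G$ by deleting the vertices of $S$. *)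

(* Defs.v *)
From HB Require Import structures.
From mathcomp Require Import all_boot.

Set Implicit Arguments.
Unset Strict Implicit.
Unset Printing Implicit Defensive.

Record sgraph := SGraph {
  vertex :> finType;
  edge : rel vertex;
  edge_sym : symmetric edge;
  edge_irrefl : irreflexive edge
}.

Section Defs.
Variable G : sgraph.
Implicit Types (u v x y : G) (L : {ffun G -> {ffun G -> bool}}).

(* [x :: p] is a path (no repeated vertex) from [x] to [y]; its length is
   [size p]. *)
Definition is_path x y (p : seq G) :=
  [&& path (@edge G) x p, last x p == y & uniq (x :: p)].

(* [L x y] reads "x is at most y"; finfuns make the set of all orders finite. *)
Definition linear_order L :=
  [&& [forall x, L x x],
      [forall x, forall y, L x y && L y x ==> (x == y)],
      [forall x, forall y, forall z, L x y && L y z ==> L x z] &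
      [forall x, forall y, L x y || L y x]].

Definition wreach (r : nat) L v : {set G} :=
  [set u | [exists p : r.-bseq G, is_path v u p && all (L u) (v :: p)]].

Definition wcol_order (r : nat) L := \max_(v : G) #|wreach r L v|.

(* The default [#|G|] of the minimum is harmless: it bounds every term, and
   linear orders exist; see [wcol_attained] and [wcol_min]. *)
Definition wcol (r : nat) : nat :=
  \big[minn/#|G|]_(L | linear_order L) wcol_order r L.

(* [None] is infinity. Paths have fewer than [#|G|] edges, so the head of the
   list is the least length of a path from [x] to [y]. *)
Definition dist x y : option nat :=
  ohead [seq n <- iota 0 #|G| | [exists p : n.-tuple G, is_path x y p]].

Definition dist_gt x y (r : nat) : Prop :=
  if dist x y is Some d then r < d else True.

Definition r_independent (r : nat) (B : {set G}) : Prop :=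
  forall a b, a \in B -> b \in B -> a <> b -> dist_gt a b r.

Lemma wcol_min r L : linear_order L -> wcol r <= wcol_order r L.
Proof.
move=> hL; rewrite /wcol -big_filter.
have: L \in [seq L <- index_enum _ | linear_order L].
  by rewrite mem_filter hL mem_index_enum.
elim: [seq _ <- _ | _] => //= L' s IH; rewrite inE big_cons => /orP[/eqP->|/IH].
  exact: geq_minl.
exact: leq_trans (geq_minr _ _).
Qed.

Lemma linear_order_exists : exists L, linear_order L.
Proof.
exists [ffun x => [ffun y : G => enum_rank x <= enum_rank y]].
apply/and4P; split.
- by apply/forallP=> x; rewrite !ffunE.
- apply/forallP=> x; apply/forallP=> y; rewrite !ffunE; apply/implyP=> h.
  by apply/eqP/enum_rank_inj/val_inj/eqP; rewrite eqn_leq.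
- apply/forallP=> x; apply/forallP=> y; apply/forallP=> z; rewrite !ffunE.
  by apply/implyP=> /andP[]; apply: leq_trans.
- by apply/forallP=> x; apply/forallP=> y; rewrite !ffunE leq_total.
Qed.

Lemma wcol_attained r : exists2 L, linear_order L & wcol_order r L = wcol r.
Proof.
have ub L : wcol_order r L <= #|G| by apply/bigmax_leqP=> v _; apply: max_card.
have [L0 hL0] := linear_order_exists.
have [heq|[L hL hw]] : wcol r = #|G| \/
    exists2 L, linear_order L & wcol_order r L = wcol r.
  rewrite /wcol; apply: (big_ind (fun n => n = #|G| \/
    exists2 L, linear_order L & wcol_order r L = n)).
  - by left.
  - by move=> a b ha hb; case: (leqP a b).
  - by move=> L hL; right; exists L.
- exists L0 => //; apply/eqP; rewrite eqn_leq wcol_min // andbT heq; exact: ub.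
- by exists L.
Qed.

Lemma dist_gtP x y r :
  dist_gt x y r <-> (forall p, is_path x y p -> r < size p).
Proof.
have bound p : is_path x y p -> size p < #|G|.
  by case/and3P=> _ _ /card_uniqP /= <-; apply: max_card.
pose P n := [exists p : n.-tuple G, is_path x y p].
have PP p : is_path x y p -> P (size p).
  by move=> hp; apply/existsP; exists (in_tuple p).
rewrite /dist_gt /dist -/P.
case E: (filter P _) => [|d s] /=.
  split=> // _ p hp; have: size p \in filter P (iota 0 #|G|).
    by rewrite mem_filter mem_iota add0n bound // PP.
  by rewrite E.
split=> [hr p hp|].
  have hin: size p \in filter P (iota 0 #|G|).
    by rewrite mem_filter mem_iota add0n bound // PP.
  have := sorted_filter leq_trans P (iota_sorted 0 #|G|).
  rewrite E /= => /(order_path_min leq_trans)/allP hs.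
  move: hin; rewrite E inE => /orP[/eqP->//|/hs]; exact: leq_trans.
move=> h; have: d \in filter P (iota 0 #|G|) by rewrite E mem_head.
rewrite mem_filter => /andP[/existsP[p hp] _].
by rewrite -(size_tuple p); apply: h.
Qed.

End Defs.

Section Deletion.
Variables (G : sgraph) (S : {set G}).

Let del_edge (x y : {x : G | x \notin S}) := edge (val x) (val y).

Fact del_edge_sym : symmetric del_edge.
Proof. by move=> x y; apply: edge_sym. Qed.

Fact del_edge_irrefl : irreflexive del_edge.
Proof. by move=> x; apply: edge_irrefl. Qed.

Definition del_vertices : sgraph := SGraph del_edge_sym del_edge_irrefl.

(* The vertices of [G - S] seen as vertices of [G]. *)
Definition del_val (x : del_vertices) : G := val x.
End Deletion.

Arguments wcol : clear implicits.
Arguments del_vertices : clear implicits.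

(* Main.v *)
(** Fix an order [L] with all weak reachability sets of size at most [c], and
    put [W v] for that of [v] without [v].  Colouring greedily along [L] gives
    a subset [A'] of [A], of size at least [2 ^ m], with no member of [A'] in
    the [W] of another.  A path of length at most [r] between two members [a],
    [b] of [A'] has its [L]-minimum in [W a :&: W b], so it is enough to make
    [m] of the sets [W a] pairwise disjoint by deleting few points.
    Repeatedly choose [a] among the remaining candidates: if at least half of
    the others have [W b] disjoint from [W a], keep those; otherwise delete
    [W a] and keep the ones whose [W b] meets it, and hence shrinks.  Both ways
    [a] joins [B] and the candidates are at worst halved, and the second case
    occurs at most [c - 1] times. *)
Require Import Defs.
From mathcomp Require Import all_boot.

Set Implicit Arguments.
Unset Strict Implicit.
Unset Printing Implicit Defensive.

Lemma exists_seq_min (T : eqType) (e : rel T) x (s : seq T) :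
  reflexive e -> transitive e -> total e ->
  exists2 u, u \in x :: s & all (e u) (x :: s).
Proof.
move=> er et eT; elim: s x => [|y s IHs] x.
  by exists x; rewrite ?mem_head //= er.
have [u us /allP umin] := IHs y.
have [xu|ux] := orP (eT x u).
  exists x; first exact: mem_head.
  by apply/allP=> z; rewrite inE => /predU1P[->|/umin /(et _ _ _ xu)].
exists u; first by rewrite inE us orbT.
by apply/allP=> z; rewrite inE => /predU1P[->|/umin].
Qed.

(** Induction on [#|X|]: remove the [e]-maximum [v] of [X] and colour the rest. At most [k] of the
    [k.+1] colours occur on [N v], so one is free for [v]; by maximality [v] lies in no [N w] with
    [w] in [X], so no other constraint arises. *)
Lemma greedy_coloring (T : finType) (e : rel T) (N : T -> {set T}) k :
  reflexive e -> transitive e -> total e ->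
  (forall v u, u \in N v -> ~~ e v u) -> (forall v, #|N v| <= k) ->
  forall X : {set T}, exists f : T -> 'I_k.+1,
    {in X &, forall u v, u \in N v -> f u != f v}.
Proof.
move=> er et eT Ne Nk X; have [n] := ubnP #|X|; elim: n X => // n IHn X.
rewrite ltnS => Xn; have [->|[x xX]] := set_0Vmem X.
  by exists (fun=> ord0) => u v; rewrite inE.
have [v] : exists2 v, v \in X & {in X, forall u, e u v}.
  (* A maximum for [e] is a minimum for the reversed relation. *)
  have eV : [/\ reflexive (fun y z => e z y), transitive (fun y z => e z y)
              & total (fun y z => e z y)].
    by split=> // y x' z h1 h2; apply: et h2 h1.
  case: eV => /exists_seq_min/[apply]/[apply]/(_ x (enum X)) [v vX vmax].
  exists v => [|u uX]; first by move: vX; rewrite inE mem_enum => /predU1P[->|].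
  by apply: (allP vmax); rewrite inE mem_enum uX orbT.
move=> vX vmax.
have [|f fP] := IHn (X :\ v).
  by move: Xn; rewrite (cardsD1 v X) vX.
have [i iN] : exists i, i \notin f @: N v.
  apply/existsP; rewrite -negb_forall; apply/negP => /forallP iN.
  have: #|'I_k.+1| <= #|f @: N v| by apply/subset_leq_card/subsetP=> i _.
  rewrite card_ord leqNgt ltnS.
  by rewrite (leq_trans (leq_imset_card _ _)).
exists (fun z => if z == v then i else f z) => u w uX wX uw.
have [uE|uv] := eqVneq u v.
  by have := Ne _ _ uw; rewrite uE vmax.
have [wE|wv] := eqVneq w v.
  by apply: contraNneq iN => <-; apply: imset_f; rewrite -wE.
by apply: fP; rewrite // !inE ?uv ?wv.
Qed.

Lemma large_fiber (T : finType) k (f : T -> 'I_k) (A : {set T}) n :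
  k * n < #|A| -> exists i, n < #|[set x in A | f x == i]|.
Proof.
move=> hA; apply/existsP; rewrite -[X in is_true X]negbK negb_exists.
apply: contraL hA => /forallP hn; rewrite -leqNgt -sum1_card.
rewrite (partition_big f predT) //= -[k in k * n]card_ord -sum_nat_const.
apply: leq_sum => i _; have := hn i; rewrite -leqNgt -sum1_card.
by under eq_bigl => x do rewrite inE.
Qed.

(** ['C(k.+1, 2)] is [k + (k - 1) + ... + 1], since each deletion lowers by one the size bound for
    the sets that remain. Keeping [S] inside the union of the [W a] later ensures that [S] misses
    [B]. *)
Lemma disjoint_after_deletion (I T : finType) m k (W : I -> {set T})
    (A : {set I}) :
  {in A, forall a, #|W a| <= k} -> 2 ^ m <= #|A|.+1 ->
  exists (S : {set T}) (B : {set I}),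
    [/\ #|S| <= 'C(k.+1, 2), S \subset \bigcup_(a in A) W a, B \subset A,
        m <= #|B| & {in B &, forall a b, a != b -> W a :&: W b \subset S}].
Proof.
elim: m k W A => [|m IHm] k W A Wk hA.
  exists set0, set0; rewrite cards0 !sub0set; split=> // a.
  by rewrite inE.
have [A0|[a aA]] := set_0Vmem A.
  by move: hA; rewrite A0 cards0 leqNgt -[1](expn0 2) ltn_exp2l.
pose D := [set b | [disjoint W a & W b]].
have: 2 ^ m <= #|(A :\ a) :&: D|.+1 \/ 2 ^ m <= #|(A :\ a) :\: D|.+1.
  (* Taking out [a] turns [#|A|.+1] into the sum of the two parts' sizes, each increased by one;
     this is why the bound is on [#|A|.+1]. *)
  have hD : 2 ^ m.+1 <= (#|(A :\ a) :&: D|.+1 + #|(A :\ a) :\: D|.+1).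
    by rewrite addSn addnS cardsID; move: hA; rewrite (cardsD1 a A) aA.
  apply/orP; apply: contraLR hD; rewrite negb_or -!ltnNge => /andP[h1 h2].
  by rewrite expnS mul2n -addnn -addSn leq_add // ltnW.
have subA (E : {set I}) : E \subset A :\ a -> E \subset A.
  by move=> h; apply: subset_trans h (subsetDl _ _).
have notin (E : {set I}) : E \subset A :\ a -> a \notin E.
  by move=> /subsetP h; apply/negP => /h; rewrite !inE eqxx.
case=> hm.
  have [|S [B [Sk SW BA mB BS]]] := IHm k W _ _ hm.
    by move=> b /setIP[/setD1P[_ /Wk]].
  have aB : {in B, forall b, W a :&: W b \subset S}.
    move=> b /(subsetP BA)/setIP[_]; rewrite inE -setI_eq0 => /eqP->.
    exact: sub0set.
  have BAa : B \subset A :\ a := subset_trans BA (subsetIl _ _).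
  exists S, (a |: B); split=> //.
  - apply: subset_trans SW _; apply/bigcupsP=> b /setIP[/setD1P[_ bA] _].
    exact: bigcup_sup.
  - by rewrite subUset sub1set aA subA.
  - by rewrite cardsU1 (notin B BAa).
  - move=> b b' /setU1P[->|bB] /setU1P[->|b'B]; rewrite ?eqxx // => bb'.
    + exact: aB.
    + by rewrite setIC; apply: aB.
    + exact: BS.
(* Here every [W b] meets [W a], so removing [W a] costs it at least one point. *)
have k'W : {in (A :\ a) :\: D, forall b, #|W b :\: W a| <= k.-1}.
  move=> b /setDP[/setD1P[_ bA]]; rewrite inE -setI_eq0 -card_gt0 => Wab.
  rewrite -subn1 cardsD setIC; apply: leq_sub Wab; exact: Wk.
have [S [B [Sk SW BA mB BS]]] := IHm _ _ _ k'W hm.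
have BAa : B \subset A :\ a := subset_trans BA (subsetDl _ _).
exists (W a :|: S), (a |: B); split.
- apply: leq_trans (leq_card_setU _ _) _; have := Wk _ aA.
  (* For [k = 0] the predecessor [k.-1] is still [0], but then [W a] is empty; otherwise Pascal's
     rule adds the two bounds. *)
  case: (k) Sk => [|j] /= Sj Wj; first by rewrite -[0]/(0 + 0) leq_add.
  by rewrite [leqRHS]binS bin1 addnC leq_add.
- rewrite subUset bigcup_sup //=; apply: subset_trans SW _.
  apply/bigcupsP=> b /setDP[/setD1P[_ bA] _].
  by apply: subset_trans (subsetDl _ _) _; apply: bigcup_sup.
- by rewrite subUset sub1set aA subA.
- by rewrite cardsU1 (notin B BAa).
- move=> b b' /setU1P[->|bB] /setU1P[->|b'B]; rewrite ?eqxx // => bb'.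
  + exact: subset_trans (subsetIl _ _) (subsetUl _ _).
  + exact: subset_trans (subsetIr _ _) (subsetUl _ _).
  + apply/subsetP=> x /setIP[xb xb']; rewrite inE.
    have [//|xa] := boolP (x \in W a).
    by apply: (subsetP (BS _ _ bB b'B bb')); rewrite !inE xa xb.
Qed.

Lemma is_path_rev (G : sgraph) (x y : G) p :
  is_path x y p -> is_path y x (rev (belast x p)).
Proof.
case/and3P=> xp /eqP<- xu; apply/and3P; split.
- by rewrite rev_path (eq_path (e' := @edge G)) // => u v; apply: edge_sym.
- by case: p {xp xu} => //= z p; rewrite rev_cons last_rcons.
- by rewrite -rev_rcons -lastI rev_uniq.
Qed.

Lemma mem_rev_path (G : sgraph) (x y : G) p :
  is_path x y p -> y :: rev (belast x p) =i x :: p.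
Proof.
by case/and3P=> _ /eqP<- _ u; rewrite -rev_rcons -lastI mem_rev.
Qed.

(** Cut the path at [u]: the initial segment is no longer and still has [u] as its minimum. *)
Lemma wreach_path_min (G : sgraph) r (L : {ffun G -> {ffun G -> bool}})
    (x y u : G) p :
  is_path x y p -> size p <= r -> u \in x :: p -> all (L u) (x :: p) ->
  u \in wreach r L x.
Proof.
move=> xyp pr /splitPl pu; case: pu xyp pr => p1 p2 p1u.
rewrite /is_path cat_path -cat_cons cat_uniq all_cat size_cat.
case/and3P=> /andP[xp1 _] _ /and3P[up1 _ _] pr /andP[Lp1 _].
have p1r : size p1 <= r := leq_trans (leq_addr _ _) pr.
rewrite inE; apply/existsP; exists (Bseq p1r).
by rewrite /is_path /= xp1 p1u eqxx -[(x \notin p1) && _]/(uniq (x :: p1)) up1.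
Qed.

Lemma wreach_path_min_last (G : sgraph) r (L : {ffun G -> {ffun G -> bool}})
    (x y u : G) p :
  is_path x y p -> size p <= r -> u \in x :: p -> all (L u) (x :: p) ->
  u \in wreach r L y.
Proof.
move=> xyp pr up Lp; apply: (wreach_path_min (is_path_rev xyp)).
- by rewrite size_rev size_belast.
- by rewrite (mem_rev_path xyp).
- by rewrite (eq_all_r (mem_rev_path xyp)).
Qed.

Lemma wreach_le (G : sgraph) r (L : {ffun G -> {ffun G -> bool}})
    (u v : G) : u \in wreach r L v -> L u v.
Proof. by rewrite inE => /existsP[p /andP[_ /andP[]]]. Qed.

Lemma wreach_self (G : sgraph) r (L : {ffun G -> {ffun G -> bool}})
    (v : G) : L v v -> v \in wreach r L v.
Proof.
move=> Lv; rewrite inE; apply/existsP; exists (@Bseq r G [::] isT).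
by rewrite /is_path /= eqxx Lv.
Qed.

Lemma linear_orderP (G : sgraph) (L : {ffun G -> {ffun G -> bool}}) :
  linear_order L ->
  [/\ reflexive (fun x => L x), antisymmetric (fun x => L x),
      transitive (fun x => L x) & total (fun x => L x)].
Proof.
case/and4P=> /forallP Lr /forallP La /forallP Lt /forallP LT; split=> //.
- by move=> x y Lxy; have /forallP/(_ y)/implyP/(_ Lxy)/eqP := La x.
- move=> y x z Lxy Lyz.
  by have /forallP/(_ y)/forallP/(_ z) := Lt x; rewrite Lxy Lyz.
- by move=> x y; have /forallP := LT x.
Qed.

Lemma is_path_del_val (G : sgraph) (S : {set G}) (x y : del_vertices G S) p :
  is_path x y p -> is_path (del_val x) (del_val y) [seq del_val z | z <- p].
Proof.
case/and3P=> xp /eqP<- xu; apply/and3P; split.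
- by rewrite path_map.
- by rewrite last_map.
- by rewrite -map_cons map_inj_uniq //; apply: val_inj.
Qed.

Theorem theorem4 (G : sgraph) (r m c : nat) (A : {set G})
    (hc : wcol G r <= c) (hA : (c + 1) * 2 ^ m <= #|A|) :
  exists (S : {set G}) (B : {set del_vertices G S}),
    [/\ #|S| <= c * (c - 1),
        [set del_val x | x in B] \subset A,
        m <= #|B| &
        r_independent r B].
Proof.
have [L /linear_orderP[Lr La Lt LT] Lw] := wcol_attained G r.
have Rc v : #|wreach r L v| <= c.
  by apply: leq_trans hc; rewrite -Lw; apply: (leq_bigmax v).
pose W v := wreach r L v :\ v.
have Wc v : #|W v| < c.
  by apply: leq_trans (Rc v); rewrite [leqRHS](cardsD1 v) wreach_self.
have m_gt0 : 0 < 2 ^ m by rewrite expn_gt0.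
have [a0 _] : exists a, a \in A.
  by apply/card_gt0P; apply: leq_trans hA; rewrite addn1 muln_gt0.
(* [c = 0] is impossible as [#|W a0| < c]; with [c = k.+1] each [W v] has at most [k] points, so [c]
   colours suffice. *)
case: c hc hA {Rc} Wc => [|k] _ hA Wk; first by have := Wk a0.
have WL v u : u \in W v -> ~~ L v u.
  case/setD1P=> uv /wreach_le Luv; apply: contra_neqN uv => Lvu.
  by apply: La; rewrite Luv Lvu.
have [f fP] := greedy_coloring Lr Lt LT WL Wk setT.
have [|i Ai] := @large_fiber _ _ f A (2 ^ m).
  by apply: leq_trans hA; rewrite addn1 ltn_mul2r m_gt0 ltnSn.
have [S [B [Sk SW BA mB BS]]] :=
  disjoint_after_deletion (fun v _ => Wk v) (leqW (ltnW Ai)).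
have AiW a b : a \in [set x in A | f x == i] -> b \in [set x in A | f x == i] ->
    a \notin W b.
  move=> /setIdP[_ /eqP fa] /setIdP[_ /eqP fb]; apply/negP=> ab.
  by have := fP _ _ (in_setT a) (in_setT b) ab; rewrite fa fb eqxx.
(* [S] lies in the union of the [W b] over one colour class, and these sets contain no vertex of
   that class. *)
have BnS a : a \in B -> a \notin S.
  move=> /(subsetP BA) aA; apply/negP => /(subsetP SW)/bigcupP[b bA].
  exact/negP/AiW.
have BE : [set del_val x | x in [set x : del_vertices G S | del_val x \in B]] = B.
  apply/setP=> a; apply/imsetP/idP => [[x]|aB]; first by rewrite inE => xB ->.
  by exists (Sub a (BnS a aB)); rewrite ?inE /del_val SubK.
exists S, [set x : del_vertices G S | del_val x \in B]; rewrite BE; split.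
- apply: leq_trans Sk _; by rewrite bin2 subn1 -divn2 leq_div.
- by apply: subset_trans BA _; apply/subsetP=> x; rewrite inE => /andP[].
- by rewrite -BE in mB; apply: leq_trans mB (leq_imset_card _ _).
(* The minimum [u] of a short path in [G - S] would lie in both [W (del_val a)] and [W (del_val b)],
   hence in [S], which the path avoids. *)
move=> a b; rewrite !inE => aB bB ab; apply/dist_gtP => p pab.
rewrite ltnNge; apply/negP => pr.
have pG := is_path_del_val pab.
have prG : size [seq del_val z | z <- p] <= r by rewrite size_map.
have [u up Lu] := exists_seq_min (del_val a)
  [seq del_val z | z <- p] Lr Lt LT.
have ua := wreach_path_min pG prG up Lu.
have ub := wreach_path_min_last pG prG up Lu.
have abN : del_val a != del_val b.
  by apply/eqP => /val_inj.
have aA := subsetP BA _ aB; have bA := subsetP BA _ bB.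
(* If [u] were an endpoint, it would lie in the [W] of the other endpoint, which has the same
   colour. *)
have uaN : u != del_val a.
  apply: contraTneq ub => uE; have := AiW _ _ aA bA.
  by rewrite inE inE abN uE.
have ubN : u != del_val b.
  apply: contraTneq ua => uE; have := AiW _ _ bA aA.
  by rewrite inE inE eq_sym abN uE.
have uS : u \in S.
  apply: (subsetP (BS _ _ aB bB abN)).
  by rewrite inE !in_setD1 uaN ubN ua ub.
move: up; rewrite -map_cons => /mapP[z _ uz].
by have := valP z; rewrite -[val z]/(del_val z) -uz uS.
Qed.
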